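(* Let $d\ge 1$, $n\ge 3$, let $u\in\mathbb{C}\setminus\{0\}$, and let $z,x_1,\ldots,x_{d-1}\in\mathbb{C}$ be the parameters of the Markov trace $\mathrm{tr}$ on $\bigcup_{n}\mathrm{Y}_{d,n}(u)$. Put $x_0=1$ and let $x:\mathbb{Z}/d\mathbb{Z}\to\mathbb{C}$, $k\mapsto x_k$, with Fourier transform $\widehat{x}(m)=\sum_{k=0}^{d-1}x_k\,e^{-2\pi i km/d}$. Then $\mathrm{tr}$ passes to the quotient algebra $\mathrm{FTL}_{d,n}(u)$ if and only if there are disjoint subsets $\mathrm{Sup}_1,\mathrm{Sup}_2\subseteq\mathbb{Z}/d\mathbb{Z}$ with $\mathrm{Sup}_1\cup\mathrm{Sup}_2$ equal to the support $\{m:\widehat{x}(m)\neq 0\}$ of $\widehat{x}$, such that $$x_k=-z\Big(\sum_{m\in\mathrm{Sup}_1}e^{2\pi i km/d}+(u+1)\sum_{m\in\mathrm{Sup}_2}e^{2\pi i km/d}\Big)\quad(k\in\mathbb{Z}/d\mathbb{Z})\qquad\text{and}\qquad z=-\frac{1}{|\mathrm{Sup}_1|+(u+1)|\mathrm{Sup}_2|}.$$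
   Context: The Yokonuma–Hecke algebra $\mathrm{Y}_{d,n}(u)$ is the unital associative $\mathbb{C}$-algebra with generators $g_1,\ldots,g_{n-1},t_1,\ldots,t_n$ and relations: $g_ig_j=g_jg_i$ for $|i-j|>1$; $g_{i+1}g_ig_{i+1}=g_ig_{i+1}g_i$; $t_it_j=t_jt_i$; $t_i^d=1$; $g_it_i=t_{i+1}g_i$; $g_it_{i+1}=t_ig_i$; $g_it_j=t_jg_i$ for $j\ne i,i+1$; $g_i^2=1+(u-1)e_i+(u-1)e_ig_i$, where $e_i=\frac1d\sum_{s=0}^{d-1}t_i^st_{i+1}^{d-s}$. There are natural inclusions $\mathrm{Y}_{d,n}(u)\subset\mathrm{Y}_{d,n+1}(u)$. For $w\in S_n$ with reduced expression $s_{i_1}\cdots s_{i_k}$ ($s_i=(i,i+1)$) put $g_w=g_{i_1}\cdots g_{i_k}$ (well defined). Let $g_{i,i+1}=\sum_{w\in\langle s_i,s_{i+1}\rangle}g_w$ (sum over the six elements of the subgroup of $S_n$ generated by $s_i,s_{i+1}$), and $r_{i,i+1}=\sum_{a,b=0}^{d-1}t_i^{a}t_{i+1}^{b-a}t_{i+2}^{-b}\,g_{i,i+1}$ for $1\le i\le n-2$ (this is the sum of $g_x$ over the subgroup $\langle t_it_{i+1}^{-1},t_{i+1}t_{i+2}^{-1}\rangle\rtimes\langle s_i,s_{i+1}\rangle$ of $(\mathbb{Z}/d\mathbb{Z})^n\rtimes S_n$, where $g_{t_1^{a_1}\cdots t_n^{a_n}w}=t_1^{a_1}\cdots t_n^{a_n}g_w$).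 $\mathrm{FTL}_{d,n}(u)$ is the quotient of $\mathrm{Y}_{d,n}(u)$ by the two-sided ideal generated by $r_{1,2},\ldots,r_{n-2,n-1}$. For complex numbers $z,x_1,\ldots,x_{d-1}$ there is a unique linear map $\mathrm{tr}$ on $\bigcup_n\mathrm{Y}_{d,n}(u)$ with $\mathrm{tr}(ab)=\mathrm{tr}(ba)$, $\mathrm{tr}(1)=1$, $\mathrm{tr}(ag_n)=z\,\mathrm{tr}(a)$, $\mathrm{tr}(at_{n+1}^s)=x_s\,\mathrm{tr}(a)$ for $a,b\in\mathrm{Y}_{d,n}(u)$, $1\le s\le d-1$. ''$\mathrm{tr}$ passes to $\mathrm{FTL}_{d,n}(u)$'' means $\mathrm{tr}$ vanishes on the defining two-sided ideal of $\mathrm{FTL}_{d,n}(u)$ in $\mathrm{Y}_{d,n}(u)$. *)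

(* Defs.v *)
From mathcomp Require Import all_boot all_order all_algebra.
From mathcomp Require Import reals trigo Rstruct.
From mathcomp.real_closed Require Import complex.
Set Implicit Arguments. Unset Strict Implicit. Unset Printing Implicit Defensive.
Import GRing.Theory Num.Theory.
Local Open Scope ring_scope.
Local Open Scope complex_scope.

Definition C : fieldType := (Rdefinitions.R)[i].

Definition omega (d : nat) : C :=
  (cos (2 * pi / d%:R : Rdefinitions.R)) +i* (sin (2 * pi / d%:R : Rdefinitions.R)).

(** Letters of the free monoid on the generators g_i, t_i (1-based indices;
    index 0 letters are never generators and are excluded by [gen_in]). *)
Inductive letter := Gl of nat | Tl of nat.
Definition word := seq letter.

(** A word lies in (the image of the free algebra on the generators of) Y_{d,n}:
    it uses only g_1..g_{n-1}, t_1..t_n. *)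
Definition letter_in (n : nat) (l : letter) : bool :=
  match l with
  | Gl i => ((1 <= i) && (i <= n.-1))%N
  | Tl i => ((1 <= i) && (i <= n))%N
  end.
Definition gen_in (n : nat) (w : word) : bool := all (letter_in n) w.

(** Finite formal linear combinations of words, i.e. elements of the free
    associative C-algebra on the letters. *)
Definition comb := seq (C * word).
Definition cw (w : word) : comb := [:: (1, w)].
Definition cone : comb := cw [::].
Definition cadd (a b : comb) : comb := a ++ b.
Definition cscale (c : C) (a : comb) : comb := [seq (c * p.1, p.2) | p <- a].
Definition copp (a : comb) : comb := cscale (-1) a.
Definition csub (a b : comb) : comb := cadd a (copp b).
Definition cmul (a b : comb) : comb :=
  [seq (p.1 * q.1, p.2 ++ q.2) | p <- a, q <- b].
Definition csum (l : seq comb) : comb := flatten l.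

Definition ev (T : word -> C) (a : comb) : C := \sum_(p <- a) p.1 * T p.2.

Definition g (i : nat) : comb := cw [:: Gl i].
Definition tpow (i k : nat) : comb := cw (nseq k (Tl i)).
Definition t (i : nat) : comb := tpow i 1.

Definition e_ (d i : nat) : comb :=
  cscale (d%:R)^-1 (csum [seq cmul (tpow i s) (tpow i.+1 (d - s)) | s <- iota 0 d]).

Inductive YH_rel (d : nat) (u : C) : comb -> Prop :=
  | rel_gg i j : (1 <= i)%N -> (1 <= j)%N -> (i.+1 < j)%N \/ (j.+1 < i)%N ->
      YH_rel d u (csub (cmul (g i) (g j)) (cmul (g j) (g i)))
  | rel_braid i : (1 <= i)%N ->
      YH_rel d u (csub (cmul (g i.+1) (cmul (g i) (g i.+1)))
                       (cmul (g i) (cmul (g i.+1) (g i))))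
  | rel_tt i j : (1 <= i)%N -> (1 <= j)%N ->
      YH_rel d u (csub (cmul (t i) (t j)) (cmul (t j) (t i)))
  | rel_td i : (1 <= i)%N -> YH_rel d u (csub (tpow i d) cone)
  | rel_gt1 i : (1 <= i)%N ->
      YH_rel d u (csub (cmul (g i) (t i)) (cmul (t i.+1) (g i)))
  | rel_gt2 i : (1 <= i)%N ->
      YH_rel d u (csub (cmul (g i) (t i.+1)) (cmul (t i) (g i)))
  | rel_gt3 i j : (1 <= i)%N -> (1 <= j)%N -> j != i -> j != i.+1 ->
      YH_rel d u (csub (cmul (g i) (t j)) (cmul (t j) (g i)))
  | rel_quad i : (1 <= i)%N ->
      YH_rel d u (csub (cmul (g i) (g i))
                   (cadd cone (cadd (cscale (u - 1) (e_ d i))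
                                    (cscale (u - 1) (cmul (e_ d i) (g i)))))).

(** A word functional T is (the restriction to words of) a linear map on the
    union of the Y_{d,n}(u): it vanishes on the two-sided ideal generated by
    the defining relations. *)

Definition is_markov_trace (d : nat) (u z : C) (x : nat -> C) (T : word -> C) : Prop :=
  [/\ (* well defined on the union of the Y_{d,n}(u) *)
      (forall (N : nat) (a b : word) (r : comb), gen_in N a -> gen_in N b ->
         YH_rel d u r -> ev T (cmul (cw a) (cmul r (cw b))) = 0),
      T [::] = 1,
      (forall (n : nat) (a b : word), gen_in n a -> gen_in n b ->
         T (a ++ b) = T (b ++ a)),
      (forall (n : nat) (a : word), (1 <= n)%N -> gen_in n a ->
         T (a ++ [:: Gl n]) = z * T a) &
      (forall (n s : nat) (a : word), (1 <= n)%N -> gen_in n a ->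
         (1 <= s <= d.-1)%N -> T (a ++ nseq s (Tl n.+1)) = x s * T a)].

(** g_{i,i+1} : sum of g_w over <s_i, s_{i+1}> *)
Definition g2 (i : nat) : comb :=
  csum [:: cone; g i; g i.+1; cmul (g i) (g i.+1); cmul (g i.+1) (g i);
           cmul (g i) (cmul (g i.+1) (g i))].

(** r_{i,i+1} = sum_{a,b} t_i^a t_{i+1}^{b-a} t_{i+2}^{-b} g_{i,i+1}
    (exponents taken in N, representing the classes mod d, using t^d = 1). *)
Definition r_ (d i : nat) : comb :=
  cmul (csum [seq cmul (tpow i a) (cmul (tpow i.+1 (b + d - a)) (tpow i.+2 (d - b)))
             | a <- iota 0 d, b <- iota 0 d]) (g2 i).

(** tr passes to FTL_{d,n}(u): tr vanishes on the two-sided ideal of Y_{d,n}(u)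
    generated by r_{1,2}, ..., r_{n-2,n-1}. *)
Definition passes_FTL (d n : nat) (T : word -> C) : Prop :=
  forall (a b : word) (i : nat), gen_in n a -> gen_in n b -> (1 <= i <= n - 2)%N ->
    ev T (cmul (cw a) (cmul (r_ d i) (cw b))) = 0.

Definition xfun (d : nat) (x : nat -> C) (k : 'I_d) : C :=
  if val k == 0%N then 1 else x k.

Definition xhat (d : nat) (x : nat -> C) (m : 'I_d) : C :=
  \sum_(k < d) xfun x k * (omega d ^+ (k * m))^-1.

(* Main.v *)
Require Import Defs.
From HB Require Import structures.
From mathcomp Require Import all_boot all_order all_algebra.
From mathcomp Require Import generic_quotient boolp reals Rstruct trigo.
From mathcomp.real_closed Require Import complex.
From mathcomp Require Import ring zify lra.
Set Implicit Arguments. Unset Strict Implicit. Unset Printing Implicit Defensive.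
Import Order.TTheory GRing.Theory Num.Theory.
Local Open Scope ring_scope.

(** Over the complex numbers, t_i^d = 1 splits each framing generator by the
    idempotents eps_i(m) = 1/d sum_s omega^(-ms) t_i^s, and
    r_{i,i+1} = d^2 sum_m P_m g_{i,i+1} with
    P_m = eps_i(m) eps_{i+1}(m) eps_{i+2}(m).  On the image of P_m the g's satisfy
    the Hecke relation g^2 = u + (u-1) g, so g_{i,i+1} P_m is an eigenvector of
    Y_{d,3}: vanishing of tr on the ideal of Y_{d,3} means tr(P_m g_{1,2}) = 0 for
    all m.  With y_m = tr(eps_1(m)) = xhat(m)/d the trace rules give
    tr(P_m g_{1,2}) = y_m (y_m + z) (y_m + (u+1) z), so each y_m is 0, -z or
    -(u+1) z, and Fourier inversion yields the formula for x_k; the value of z is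
    the case k = 0.  For n > 3 the decomposition
    Y_{n+1} = Y_n[t_{n+1}] + Y_n g_n Y_n reduces the vanishing to Y_{d,3}, and the
    r_{i,i+1} are conjugate to each other because g_i is invertible (u <> 0).
    The computations take place in the quotient of the free algebra by the
    radical of tr, where the defining relations hold as equations. *)

(** * Roots of unity and orthogonality of characters *)

Lemma sum_expr_root_of_unity (F : fieldType) (d : nat) (w : F) :
  w ^+ d = 1 -> w != 1 -> \sum_(s < d) w ^+ s = 0.
Proof.
move=> wd w1; apply/eqP; have := subrX1 w d; rewrite wd subrr => /esym/eqP.
by rewrite mulf_eq0 subr_eq0 (negbTE w1).
Qed.

Lemma primitive_root_neq0 (F : fieldType) (d : nat) (w : F) :
  d.-primitive_root w -> w != 0.
Proof.
move=> wP; apply/eqP => w0; have := prim_expr_order wP.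
by rewrite w0 expr0n (gtn_eqF (prim_order_gt0 wP)) => /esym/eqP; rewrite oner_eq0.
Qed.

(** The summand is the s-th power of the ratio [w ^+ m / w ^+ m'], a d-th root of unity which, by
    primitivity, is 1 only when the two exponents agree. *)
Lemma prim_root_orthogonality (F : fieldType) (d : nat) (w : F) (m m' : nat) :
  d.-primitive_root w -> (m < d)%N -> (m' < d)%N ->
  \sum_(s < d) w ^+ (m * s) / w ^+ (m' * s) = (m == m')%:R * d%:R.
Proof.
move=> wP md m'd; have w0 := primitive_root_neq0 wP.
have [<-|mm'] := eqVneq m m'.
  rewrite mul1r (eq_bigr (fun=> 1)) ?sumr_const ?card_ord // => s _.
  by rewrite divff // expf_neq0.
rewrite mul0r (eq_bigr (fun s : 'I_d => (w ^+ m / w ^+ m') ^+ s)); last first.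
  by move=> s _; rewrite expr_div_n !exprM.
apply: sum_expr_root_of_unity.
  by rewrite expr_div_n -!exprM ![(_ * d)%N]mulnC !exprM (prim_expr_order wP) !expr1n divr1.
apply: contra mm' => /eqP E; have : w ^+ m == w ^+ m'.
  by rewrite -[w ^+ m](divfK (expf_neq0 m' w0)) E mul1r.
by rewrite (eq_prim_root_expr wP) !modn_small.
Qed.

(** * Yokonuma-Hecke algebras and Markov traces *)

(* Indices are 0-based, whereas the words of the statement are 1-based: [g i]
   exchanges [t i] and [t i.+1], and [yh_sub n] is the image of Y_{d,n}. *)
Section YokonumaHecke.

Variables (F : fieldType) (A : algType F) (d : nat) (u : F) (g t : nat -> A).

Definition frame_idem (i : nat) : A :=
  d%:R^-1 *: \sum_(s < d) t i ^+ s * t i.+1 ^+ (d - s).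

Record yokonuma_hecke : Prop := YokonumaHecke {
  yh_gg : forall i j, (i.+1 < j)%N -> g i * g j = g j * g i;
  yh_braid : forall i, g i.+1 * (g i * g i.+1) = g i * (g i.+1 * g i);
  yh_tt : forall i j, t i * t j = t j * t i;
  yh_td : forall i, t i ^+ d = 1;
  yh_gt1 : forall i, g i * t i = t i.+1 * g i;
  yh_gt2 : forall i, g i * t i.+1 = t i * g i;
  yh_gt3 : forall i j, j != i -> j != i.+1 -> g i * t j = t j * g i;
  yh_quad : forall i, g i * g i =
    1 + ((u - 1) *: frame_idem i + (u - 1) *: (frame_idem i * g i)) }.

(** Products grow only on the right, one generator at a time, so that induction peels off the last
    letter; closure under all products is then [yh_subM]. *)
Inductive yh_sub (n : nat) : A -> Prop :=
  | yh_sub1 : yh_sub n 1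
  | yh_sub_g a i : (i.+1 < n)%N -> yh_sub n a -> yh_sub n (a * g i)
  | yh_sub_t a i : (i < n)%N -> yh_sub n a -> yh_sub n (a * t i)
  | yh_sub0 : yh_sub n 0
  | yh_sub_lin c a b : yh_sub n a -> yh_sub n b -> yh_sub n (c *: a + b).

Lemma yh_subM n a b : yh_sub n a -> yh_sub n b -> yh_sub n (a * b).
Proof.
move=> Ya; elim=> [|b' i lt_in _ IH|b' i lt_in _ IH||c b1 b2 _ IH1 _ IH2].
- by rewrite mulr1.
- by rewrite mulrA; apply: yh_sub_g.
- by rewrite mulrA; apply: yh_sub_t.
- by rewrite mulr0; apply: yh_sub0.
- by rewrite mulrDr -scalerAr; apply: yh_sub_lin.
Qed.

Lemma yh_subG n i : (i.+1 < n)%N -> yh_sub n (g i).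
Proof. by move=> lt_in; rewrite -[g i]mul1r; apply: yh_sub_g => //; apply: yh_sub1. Qed.

Lemma yh_subT n i : (i < n)%N -> yh_sub n (t i).
Proof. by move=> lt_in; rewrite -[t i]mul1r; apply: yh_sub_t => //; apply: yh_sub1. Qed.

Lemma yh_subD n a b : yh_sub n a -> yh_sub n b -> yh_sub n (a + b).
Proof. by move=> Ya Yb; rewrite -[a]scale1r; apply: yh_sub_lin. Qed.

Lemma yh_subZ n c a : yh_sub n a -> yh_sub n (c *: a).
Proof. by move=> Ya; rewrite -[_ *: _]addr0; apply: yh_sub_lin => //; apply: yh_sub0. Qed.

Lemma yh_subX n a k : yh_sub n a -> yh_sub n (a ^+ k).
Proof.
move=> Ya; elim: k => [|k IH]; first by rewrite expr0; apply: yh_sub1.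
by rewrite exprS; apply: yh_subM.
Qed.

Lemma yh_sub_sum n (I : finType) (f : I -> A) :
  (forall i, yh_sub n (f i)) -> yh_sub n (\sum_i f i).
Proof. by move=> Yf; elim/big_ind: _ => //; [apply: yh_sub0 | apply: yh_subD]. Qed.

Lemma yh_subS n m a : (n <= m)%N -> yh_sub n a -> yh_sub m a.
Proof.
move=> le_nm; elim=> [|b i lt_in _ IH|b i lt_in _ IH||c b1 b2 _ IH1 _ IH2].
- exact: yh_sub1.
- by apply: yh_sub_g => //; apply: leq_trans le_nm.
- by apply: yh_sub_t => //; apply: leq_trans le_nm.
- exact: yh_sub0.
- exact: yh_sub_lin.
Qed.

Lemma frame_idem_sub n i : (i.+1 < n)%N -> yh_sub n (frame_idem i).
Proof.
move=> lt_in; apply/yh_subZ/yh_sub_sum => s.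
by apply: yh_subM; apply/yh_subX/yh_subT => //; apply: ltnW.
Qed.

Hypothesis YH : yokonuma_hecke.

Lemma exp_intertwine (a b c : A) k : a * b = c * a -> a * b ^+ k = c ^+ k * a.
Proof.
move=> ab; elim: k => [|k IH]; first by rewrite !expr0 mulr1 mul1r.
by rewrite exprSr mulrA IH -mulrA ab mulrA -exprSr.
Qed.

(** With 0-based indices [yh_sub n] is generated by the [g i] with i + 1 < n and the [t i] with i <
    n, all of which commute with [g n] by the distant relations. *)
Lemma yh_sub_commG n a : yh_sub n a -> a * g n = g n * a.
Proof.
elim=> [|b i lt_in _ IH|b i lt_in _ IH||c b1 b2 _ IH1 _ IH2].
- by rewrite mulr1 mul1r.
- by rewrite -mulrA (yh_gg YH lt_in) mulrA IH mulrA.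
- rewrite -mulrA -(yh_gt3 YH) ?ltn_eqF //; last exact: ltnW.
  by rewrite mulrA IH mulrA.
- by rewrite mul0r mulr0.
- by rewrite mulrDl mulrDr IH2 -scalerAl -scalerAr IH1.
Qed.

Lemma yh_sub_commT n a : yh_sub n a -> a * t n = t n * a.
Proof.
elim=> [|b i lt_in _ IH|b i lt_in _ IH||c b1 b2 _ IH1 _ IH2].
- by rewrite mulr1 mul1r.
- rewrite -mulrA (yh_gt3 YH) ?gtn_eqF //; last exact: ltnW.
  by rewrite mulrA IH mulrA.
- by rewrite -mulrA (yh_tt YH) mulrA IH mulrA.
- by rewrite mul0r mulr0.
- by rewrite mulrDl mulrDr IH2 -scalerAl -scalerAr IH1.
Qed.

Lemma yh_sub_commTX n a s : yh_sub n a -> a * t n ^+ s = t n ^+ s * a.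
Proof. by move=> Ya; apply/exp_intertwine/yh_sub_commT. Qed.

(* The spanning Y_{n+1} = Y_n[t_{n+1}] + Y_n g_n Y_n behind the inductive
   definition of the Markov trace, stated through linear predicates. *)
Lemma yh_sub_span n (P : A -> Prop) :
  P 0 -> (forall c a b, P a -> P b -> P (c *: a + b)) ->
  (forall a s, yh_sub n a -> P (a * t n ^+ s)) ->
  (forall m a b, n = m.+1 -> yh_sub n a -> yh_sub n b -> P (a * g m * b)) ->
  forall a, yh_sub n.+1 a -> P a.
Proof.
have [k] := ubnP n; elim: k n P => // k IHk n P lt_nk P0 Pl Pt Pg a Ya.
(* [P] stays general in this induction: to treat a last letter, the hypothesis is applied to the
   predicate that first multiplies by this letter on the right. *)
elim: Ya P P0 Pl Pt Pg => {a}
  [|a j lt_jn _ IH|a j lt_jn _ IH||c a b _ IHa _ IHb] P P0 Pl Pt Pg.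
- by rewrite -[1]mul1r -(expr0 (t n)); apply: Pt; apply: yh_sub1.
- apply: (IH (fun b => P (b * g j))) => {IH a}.
  + by rewrite mul0r.
  + by move=> c a b Pa Pb; rewrite mulrDl -scalerAl; apply: Pl.
  + move=> a s Ya; move: lt_jn; rewrite ltnS leq_eqVlt => /orP[/eqP jn|lt_jn].
      rewrite -mulrA -jn -(exp_intertwine s (yh_gt1 YH j)) mulrA.
      by apply: Pg => //; apply/yh_subX/yh_subT; rewrite -jn.
    rewrite -mulrA -(@exp_intertwine (g j) (t n)) ?mulrA; last first.
      by apply: (yh_gt3 YH); rewrite gtn_eqF // ltnW.
    by apply: Pt; apply: yh_sub_g.
  + move=> m a b nm Ya Yb; move: lt_jn; rewrite ltnS leq_eqVlt => /orP[/eqP jn|lt_jn]; last first.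
      by rewrite -mulrA; apply: Pg => //; apply: yh_sub_g.
    have {jn} jm : j = m by apply: succn_inj; rewrite jn.
    rewrite {j}jm; rewrite {n}nm in Pt Pg lt_nk Ya Yb.
    have PD x y : P x -> P y -> P (x + y).
      by move=> Px Py; rewrite -[x]scale1r; apply: Pl.
    have PZ c x : P x -> P (c *: x).
      by move=> Px; rewrite -[_ *: _]addr0; apply: Pl.
    have Psum (I : finType) (f : I -> A) : (forall i, P (f i)) -> P (\sum_i f i).
      by move=> Pf; elim/big_ind: _.
    have lt_mm1 : (m <= m.+1)%N by [].
    (* The middle factor is caught between two copies of [g m]; the outer induction decomposes it
       one level down. *)
    apply: (IHk m (fun b => P (a * g m * b * g m))) Yb => //.
    * by rewrite mulr0 mul0r.
    * by move=> c x y Px Py; rewrite mulrDr mulrDl -scalerAr -scalerAl; apply: Pl.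
    * move=> c s Yc.
      (* [c] commutes with [g m] and the power of [t m] crosses it, which leaves the square of [g m]
         for the quadratic relation. *)
      have -> : a * g m * (c * t m ^+ s) * g m = a * c * t m.+1 ^+ s * (g m * g m).
        rewrite -[a * g m * _]mulrA [g m * (c * _)]mulrA -(yh_sub_commG Yc).
        by rewrite -[c * g m * _]mulrA (exp_intertwine s (yh_gt1 YH m)) !mulrA.
      have Yac : yh_sub m.+1 (a * c) by apply: yh_subM => //; apply: yh_subS Yc.
      have move_t p q : a * c * t m.+1 ^+ s * (t m ^+ p * t m.+1 ^+ q)
             = a * c * t m ^+ p * t m.+1 ^+ (s + q).
        rewrite -!mulrA; congr (_ * (_ * _)); rewrite exprD !mulrA; congr (_ * _).
        apply: exp_intertwine; apply/esym/exp_intertwine; exact: yh_tt YH _ _.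
      have Yacp p : yh_sub m.+1 (a * c * t m ^+ p).
        by apply: yh_subM => //; apply/yh_subX/yh_subT.
      rewrite (yh_quad YH) !mulrDr mulr1; apply: (PD); first exact: Pt.
      rewrite -!scalerAr /frame_idem -!scalerAl -!scalerAr; apply: (PD).
        do 2!apply: (PZ); rewrite mulr_sumr; apply: Psum => p.
        by rewrite move_t; apply: Pt.
      do 2!apply: (PZ); rewrite mulr_suml mulr_sumr; apply: Psum => p.
      rewrite mulrA move_t -[_ * g m]mulrA -(exp_intertwine _ (yh_gt1 YH m)) mulrA.
      by apply: Pg => //; apply/yh_subX/yh_subT.
    * move=> l c c' ml Yc Yc'; rewrite ml in Ya Yc Yc' Pg *.
      (* [c] and [c'] commute with [g l.+1], so the braid relation replaces its two occurrences by a
         single one. *)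
      have -> : a * g l.+1 * (c * g l * c') * g l.+1 = (a * c * g l) * g l.+1 * (g l * c').
        rewrite -!mulrA (yh_sub_commG Yc') [g l.+1 * (c * _)]mulrA -(yh_sub_commG Yc).
        rewrite -!mulrA; congr (_ * (_ * _)); rewrite !mulrA; congr (_ * _).
        by rewrite -!mulrA (yh_braid YH).
      apply: Pg => //.
        by apply: yh_sub_g => //; apply: yh_subM => //; apply: yh_subS Yc.
      by apply: yh_subM; [apply: yh_subG | apply: yh_subS Yc'].
- apply: (IH (fun b => P (b * t j))) => {IH a}.
  + by rewrite mul0r.
  + by move=> c a b Pa Pb; rewrite mulrDl -scalerAl; apply: Pl.
  + move=> a s Ya; move: lt_jn; rewrite ltnS leq_eqVlt => /orP[/eqP jn|lt_jn].
      by rewrite jn -mulrA -exprSr; apply: Pt.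
    rewrite -mulrA -(exp_intertwine s (yh_tt YH j n)) mulrA; apply: Pt.
    exact: yh_sub_t.
  + move=> m a b nm Ya Yb; move: lt_jn; rewrite ltnS leq_eqVlt => /orP[/eqP jn|lt_jn]; last first.
      by rewrite -mulrA; apply: Pg => //; apply: yh_sub_t.
    rewrite {j}jn -mulrA (yh_sub_commT Yb) mulrA -[a * _ * _]mulrA nm (yh_gt2 YH) mulrA.
    by apply: Pg; rewrite -?nm //; apply: yh_sub_t => //; rewrite nm.
- by [].
- by apply: (Pl); [apply: (IHa P) | apply: (IHb P)].
Qed.

(** * Spectral idempotents of the framing generators *)

Variable w : F.
Hypotheses (w_prim : d.-primitive_root w) (d_neq0 : d%:R != 0 :> F).

Let w_neq0 : w != 0 := primitive_root_neq0 w_prim.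
Let wd : w ^+ d = 1 := prim_expr_order w_prim.

Definition char_idem (i m : nat) : A :=
  d%:R^-1 *: \sum_(s < d) (w ^+ (m * s))^-1 *: t i ^+ s.

Local Notation eps := char_idem.

(** Multiplication by [t i] shifts the summation index, and the summands are d-periodic because
    [t i] and [w] both have d-th power 1. Thus [eps i m] lies in the [w ^+ m]-eigenspace of
    [t i]. *)
Lemma tX_char_idem i m k : t i ^+ k * eps i m = w ^+ (m * k) *: eps i m.
Proof.
elim: k => [|k IH]; first by rewrite muln0 !expr0 mul1r scale1r.
rewrite exprS -mulrA {}IH -scalerAr mulnS addnC exprD -scalerA; congr (_ *: _).
pose f s := (w ^+ (m * s))^-1 *: t i ^+ s.
have f_d : f d = f 0%N by rewrite /f (yh_td YH) mulnC exprM wd expr1n muln0 !expr0.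
have shift : \sum_(s < d) f s.+1 = \sum_(s < d) f s.
  have : \sum_(s < d.+1) f s = f 0%N + \sum_(s < d) f s.+1 by rewrite big_ord_recl.
  by rewrite big_ord_recr /= f_d addrC => /addrI/esym.
rewrite /eps -scalerAr scalerA mulrC -scalerA; congr (_ *: _).
rewrite -/(f _) -[in RHS]shift mulr_sumr scaler_sumr; apply: eq_bigr => s _.
rewrite /f -scalerAr -exprS scalerA; congr (_ *: _).
by rewrite mulnS exprD invfM mulrA divff ?mul1r // expf_neq0.
Qed.

Lemma char_idem_intertwine a i j m : a * t i = t j * a -> a * eps i m = eps j m * a.
Proof.
move=> ai; rewrite /eps -scalerAr -scalerAl mulr_sumr mulr_suml; congr (_ *: _).
by apply: eq_bigr => s _; rewrite -scalerAr -scalerAl (exp_intertwine s ai).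
Qed.

Lemma char_idemC i j m k : eps i m * eps j k = eps j k * eps i m.
Proof.
apply: char_idem_intertwine; apply/esym; apply: char_idem_intertwine.
exact: yh_tt YH _ _.
Qed.

Lemma char_idem_orth i m k : (m < d)%N -> (k < d)%N ->
  eps i m * eps i k = (m == k)%:R *: eps i k.
Proof.
move=> md kd; rewrite {1}/eps -scalerAl mulr_suml.
under eq_bigr => s _ do rewrite -scalerAl tX_char_idem scalerA mulrC.
rewrite -scaler_suml (prim_root_orthogonality w_prim) // scalerA mulrCA mulVf //.
by rewrite mulr1 eq_sym.
Qed.

Lemma char_idemK i m : (m < d)%N -> eps i m * eps i m = eps i m.
Proof. by move=> md; rewrite char_idem_orth // eqxx scale1r. Qed.

(** After exchanging the sums, orthogonality kills the coefficient of every power of [t i] except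
    the zeroth. *)
Lemma sum_char_idem i : \sum_(m < d) eps i m = 1.
Proof.
have d_gt0 := prim_order_gt0 w_prim.
rewrite /eps -scaler_sumr exchange_big (bigD1 (Ordinal d_gt0)) //= [X in _ + X]big1 => [|s s0].
  rewrite addr0 (eq_bigr (fun=> 1)) => [|m _]; last by rewrite muln0 expr0 invr1 scale1r.
  by rewrite sumr_const card_ord -scaler_nat scalerA mulVf // scale1r.
rewrite -scaler_suml.
have -> : \sum_(m < d) (w ^+ (m * s))^-1 = \sum_(m < d) w ^+ (0 * m) / w ^+ (s * m).
  by apply: eq_bigr => m _; rewrite mul0n expr0 mul1r mulnC.
rewrite (prim_root_orthogonality w_prim) //.
by rewrite [_ == _]eq_sym (_ : (s == 0%N :> nat) = false) ?mul0r ?scale0r //; apply: negbTE.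
Qed.

Lemma sum_root_sub m k : (m < d)%N -> (k < d)%N ->
  \sum_(s < d) w ^+ (m * s) * w ^+ (k * (d - s)) = (m == k)%:R * d%:R.
Proof.
move=> md kd; rewrite -(prim_root_orthogonality w_prim) //; apply: eq_bigr => s _.
(* The exponent [d - s] represents -s, since [w ^+ d] is 1. *)
congr (_ * _); apply: (mulIf (expf_neq0 (k * s) w_neq0)).
by rewrite -exprD -mulnDr subnK 1?ltnW // mulnC exprM wd expr1n mulVf // expf_neq0.
Qed.

Lemma frame_idem_char i m k : (m < d)%N -> (k < d)%N ->
  frame_idem i * (eps i m * eps i.+1 k) = (m == k)%:R *: (eps i m * eps i.+1 k).
Proof.
move=> md kd; rewrite -scalerAl mulr_suml.
under eq_bigr => s _.
  rewrite char_idemC -mulrA [t i.+1 ^+ _ * _]mulrA tX_char_idem.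
  rewrite -scalerAl -scalerAr -char_idemC mulrA tX_char_idem -scalerAl scalerA mulrC.
  over.
by rewrite -scaler_suml sum_root_sub // scalerA mulrCA mulVf // mulr1.
Qed.

(** Inserting the resolutions of the identity for [t i] and [t i.+1] leaves only the pairs of equal
    eigenvalues, by [frame_idem_char]. *)
Lemma frame_idemE i : frame_idem i = \sum_(m < d) eps i m * eps i.+1 m.
Proof.
rewrite -[LHS]mulr1 -(sum_char_idem i) mulr_sumr; apply: eq_bigr => m _.
rewrite -[in LHS](mulr1 (eps i m)) -(sum_char_idem i.+1) !mulr_sumr.
rewrite (bigD1 m) //= frame_idem_char // eqxx scale1r big1 ?addr0 // => k km.
rewrite frame_idem_char // (_ : (m == k :> nat) = false) ?scale0r //.
by rewrite eq_sym; apply: negbTE.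
Qed.

Lemma frame_idemK i : frame_idem i * frame_idem i = frame_idem i.
Proof.
rewrite {2 3}frame_idemE mulr_sumr; apply: eq_bigr => m _.
by rewrite frame_idem_char // eqxx scale1r.
Qed.

Lemma frame_idem_commG i : g i * frame_idem i = frame_idem i * g i.
Proof.
rewrite frame_idemE mulr_sumr mulr_suml; apply: eq_bigr => m _.
rewrite mulrA (char_idem_intertwine _ (yh_gt1 YH i)) -mulrA.
by rewrite (char_idem_intertwine _ (yh_gt2 YH i)) mulrA char_idemC.
Qed.

(** * Inverses of the braid generators *)

Hypothesis u_neq0 : u != 0.

(** On the image of [frame_idem i] the quadratic relation gives the inverse u^-1 (g - (u - 1)); on
    the complementary image g squares to 1 and is its own inverse. The formula combines both
    cases. *)
Definition yh_inv (i : nat) : A :=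
  g i + (u^-1 - 1) *: (frame_idem i + frame_idem i * g i).

Lemma yh_inv_sub n i : (i.+1 < n)%N -> yh_sub n (yh_inv i).
Proof.
move=> lt_in; have Yg := yh_subG lt_in; have Ye := frame_idem_sub lt_in.
by apply: yh_subD => //; apply/yh_subZ/yh_subD => //; apply: yh_subM.
Qed.

Lemma yh_mulVg i : yh_inv i * g i = 1.
Proof.
rewrite /yh_inv; move: (frame_idemK i) (yh_quad YH i).
move: (frame_idem i) => e ee gg.
have eg2 : e * g i * g i = u *: e + (u - 1) *: (e * g i).
  rewrite -mulrA gg !mulrDr mulr1 -!scalerAr !mulrA ee.
  by rewrite addrA; congr (_ + _); rewrite scalerBl scale1r addrCA subrr addr0.
rewrite mulrDl -scalerAl mulrDl eg2 gg -scalerDr.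
have -> : e * g i + (u *: e + (u - 1) *: (e * g i)) = u *: (e + e * g i).
  by rewrite addrCA scalerDr; congr (_ + _); rewrite scalerBl scale1r addrCA subrr addr0.
rewrite scalerA mulrBl mulVf // mul1r -addrA -scalerDl.
by rewrite [u - 1 + _]addrA subrK subrr scale0r addr0.
Qed.

Lemma yh_mulgV i : g i * yh_inv i = 1.
Proof.
rewrite -(yh_mulVg i) /yh_inv; move: (frame_idem i) (frame_idem_commG i) => e ge.
by rewrite mulrDr mulrDl -scalerAr -scalerAl mulrDr mulrDl mulrA ge.
Qed.

(** * The generators of the defining ideal and their spectral components *)

Definition tri_idem (i m : nat) : A := eps i m * eps i.+1 m * eps i.+2 m.

Definition hecke_sum (i : nat) : A :=
  1 + g i + g i.+1 + g i * g i.+1 + g i.+1 * g i + g i * g i.+1 * g i.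

Definition frame_sum (i : nat) : A :=
  \sum_(a < d) \sum_(b < d) t i ^+ a * t i.+1 ^+ (b + d - a) * t i.+2 ^+ (d - b).

Definition ftl_elt (i : nat) : A := frame_sum i * hecke_sum i.

Local Notation pp := tri_idem.

Lemma char_idem_sub n i m : (i < n)%N -> yh_sub n (eps i m).
Proof. by move=> lt_in; apply/yh_subZ/yh_sub_sum => s; apply/yh_subZ/yh_subX/yh_subT. Qed.

Lemma tri_idem_sub n i m : (i.+2 < n)%N -> yh_sub n (pp i m).
Proof.
move=> lt_in; have lt1 := ltnW lt_in; have lt0 := ltnW lt1.
by do 2?apply: yh_subM; apply: char_idem_sub.
Qed.

Lemma hecke_sum_sub n i : (i.+2 < n)%N -> yh_sub n (hecke_sum i).
Proof.
move=> lt_in; have Y0 : yh_sub n (g i) by apply/yh_subG/ltnW.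
have Y1 : yh_sub n (g i.+1) by apply/yh_subG.
have Y01 := yh_subM Y0 Y1; have Y10 := yh_subM Y1 Y0; have Y010 := yh_subM Y01 Y0.
by do 5!apply: yh_subD => //; apply: yh_sub1.
Qed.

Lemma tri_idem_commG i m : g i * pp i m = pp i m * g i.
Proof.
rewrite /tri_idem !mulrA (char_idem_intertwine _ (yh_gt1 YH i)) -[_ * g i * _]mulrA.
rewrite (char_idem_intertwine _ (yh_gt2 YH i)) mulrA -[_ * g i * _]mulrA.
have ig : g i * t i.+2 = t i.+2 * g i by apply: (yh_gt3 YH); rewrite gtn_eqF.
by rewrite (char_idem_intertwine _ ig) mulrA [_ * eps i m]char_idemC.
Qed.

Lemma tri_idem_commG1 i m : g i.+1 * pp i m = pp i m * g i.+1.
Proof.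
have ig : g i.+1 * t i = t i * g i.+1 by apply: (yh_gt3 YH); rewrite ltn_eqF.
rewrite /tri_idem !mulrA (char_idem_intertwine _ ig) -[_ * g i.+1 * _]mulrA.
rewrite (char_idem_intertwine _ (yh_gt1 YH i.+1)) mulrA -[_ * g i.+1 * _]mulrA.
rewrite (char_idem_intertwine _ (yh_gt2 YH i.+1)) mulrA; congr (_ * _).
by rewrite -!mulrA [eps i.+2 _ * _]char_idemC.
Qed.

Lemma tri_idemK i m : (m < d)%N -> pp i m * pp i m = pp i m.
Proof.
move=> md; rewrite /tri_idem -!mulrA [eps i.+2 m * (eps i m * _)]mulrA.
rewrite [eps i.+2 m * eps i m]char_idemC -[eps i m * eps i.+2 m * _]mulrA.
rewrite [eps i.+2 m * (_ * _)]mulrA [eps i.+2 m * eps i.+1 m]char_idemC.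
rewrite -[eps i.+1 m * eps i.+2 m * _]mulrA char_idemK //.
rewrite [eps i.+1 m * (eps i m * _)]mulrA [eps i.+1 m * eps i m]char_idemC.
rewrite -[eps i m * eps i.+1 m * _]mulrA !mulrA char_idemK //.
by rewrite -[_ * _ * eps i.+1 m]mulrA char_idemK //.
Qed.

(** This order exposes the factors on which [t i.+1] and [frame_idem i.+1] act. *)
Lemma tri_idemE i m : pp i m = eps i.+1 m * eps i.+2 m * eps i m.
Proof. by rewrite /tri_idem [eps i m * _]char_idemC -mulrA [eps i m * _]char_idemC mulrA. Qed.

Lemma frame_idem_tri i m : (m < d)%N -> frame_idem i * pp i m = pp i m.
Proof. by move=> md; rewrite mulrA frame_idem_char // eqxx scale1r. Qed.

Lemma frame_idem_tri1 i m : (m < d)%N -> frame_idem i.+1 * pp i m = pp i m.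
Proof. by move=> md; rewrite tri_idemE mulrA frame_idem_char // eqxx scale1r. Qed.

(* Where [f] acts as the identity, the quadratic relation becomes
   (a - u)(a + 1) = 0, so the image of 1 + a consists of u-eigenvectors. *)
Lemma hecke_absorb (f a y : A) : f * y = y -> a * f = f * a ->
  a * a = 1 + ((u - 1) *: f + (u - 1) *: (f * a)) ->
  a * (y + a * y) = u *: (y + a * y).
Proof.
move=> fy af aa; rewrite mulrDr mulrA aa !mulrDl mul1r -!scalerAl fy -af -mulrA fy.
have add1 (v : A) : v + (u - 1) *: v = u *: v.
  by rewrite scalerBl scale1r addrCA subrr addr0.
by rewrite [y + (_ + _)]addrA add1 addrCA add1 scalerDr.
Qed.

(** The six terms split along the cosets of the subgroup generated by s_i into three pairs
    [y + g i * y]. Each [y] is fixed by [frame_idem i] because [tri_idem i m] can be moved to its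
    left, so [hecke_absorb] applies to each pair. *)
Lemma hecke_sum_tri_g i m : (m < d)%N ->
  g i * (hecke_sum i * pp i m) = u *: (hecke_sum i * pp i m).
Proof.
move=> md; pose p := pp i m; pose a := g i; pose b := g i.+1.
have abs y : frame_idem i * y = y -> a * (y + a * y) = u *: (y + a * y).
  by move=> fy; apply: (@hecke_absorb (frame_idem i)) => //;
    [apply: frame_idem_commG | apply: yh_quad].
have f_stable (c : A) : c * p = p * c -> frame_idem i * (c * p) = c * p.
  by move=> cp; rewrite cp mulrA frame_idem_tri.
have ap : a * p = p * a := tri_idem_commG i m.
have bp : b * p = p * b := tri_idem_commG1 i m.
have -> : hecke_sum i * p = (p + a * p) + (b * p + a * (b * p)) + (b * a * p + a * (b * a * p)).
  by rewrite /hecke_sum !mulrDl mul1r !mulrA !addrA.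
rewrite mulrDr scalerDr; congr (_ + _); last first.
  by apply/abs/f_stable; rewrite -mulrA ap mulrA bp mulrA.
rewrite mulrDr scalerDr; congr (_ + _); apply: abs; first exact: frame_idem_tri.
exact: f_stable.
Qed.

Lemma hecke_sum_tri_g1 i m : (m < d)%N ->
  g i.+1 * (hecke_sum i * pp i m) = u *: (hecke_sum i * pp i m).
Proof.
move=> md; pose p := pp i m; pose a := g i; pose b := g i.+1.
have abs y : frame_idem i.+1 * y = y -> b * (y + b * y) = u *: (y + b * y).
  by move=> fy; apply: (@hecke_absorb (frame_idem i.+1)) => //;
    [apply: frame_idem_commG | apply: yh_quad].
have f_stable (c : A) : c * p = p * c -> frame_idem i.+1 * (c * p) = c * p.
  by move=> cp; rewrite cp mulrA frame_idem_tri1.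
have ap : a * p = p * a := tri_idem_commG i m.
have bp : b * p = p * b := tri_idem_commG1 i m.
(* The braid relation rewrites the longest term as [b * a * b], so that the terms also pair up under
   left multiplication by [b]. *)
have -> : hecke_sum i * p = (p + b * p) + (a * p + b * (a * p)) + (a * b * p + b * (a * b * p)).
  rewrite /hecke_sum !mulrDl mul1r -/a -/b -[a * b * a]mulrA -(yh_braid YH) -/a -/b.
  rewrite !mulrA -!addrA; congr (_ + _); rewrite [RHS]addrCA; congr (_ + (_ + _)).
  exact: addrCA.
rewrite mulrDr scalerDr; congr (_ + _); last first.
  by apply/abs/f_stable; rewrite -mulrA bp mulrA ap mulrA.
rewrite mulrDr scalerDr; congr (_ + _); apply: abs; first exact: frame_idem_tri1.
exact: f_stable.
Qed.

Lemma t_char_idem i m : t i * eps i m = w ^+ m *: eps i m.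
Proof. by have := tX_char_idem i m 1; rewrite expr1 muln1. Qed.

Lemma t_tri_idem i m k : (k < 3)%N -> t (i + k) * pp i m = w ^+ m *: pp i m.
Proof.
case: k => [|[|[|//]]] _; rewrite ?addn0 ?addn1 ?addn2.
- by rewrite /tri_idem !mulrA t_char_idem -!scalerAl.
- by rewrite tri_idemE !mulrA t_char_idem -!scalerAl.
- rewrite /tri_idem -mulrA [eps i.+1 m * _]char_idemC [eps i m * (_ * _)]mulrA [eps i m * eps i.+2 m]char_idemC.
  by rewrite !mulrA t_char_idem -!scalerAl.
Qed.

Lemma hecke_sum_tri_comm i m : hecke_sum i * pp i m = pp i m * hecke_sum i.
Proof.
have ap := tri_idem_commG i m; have bp := tri_idem_commG1 i m.
have abp : g i * g i.+1 * pp i m = pp i m * (g i * g i.+1).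
  by rewrite -mulrA bp mulrA ap mulrA.
have bap : g i.+1 * g i * pp i m = pp i m * (g i.+1 * g i).
  by rewrite -mulrA ap mulrA bp mulrA.
have abap : g i * g i.+1 * g i * pp i m = pp i m * (g i * g i.+1 * g i).
  by rewrite -mulrA ap mulrA abp !mulrA.
by rewrite /hecke_sum !mulrDl !mulrDr mul1r mulr1 ap bp abp bap abap.
Qed.

(** Every generator acts on this element by a scalar, [u] for the [g i] and [w ^+ m] for the [t i]:
    the left ideal it spans in Y_{d,3} is at most a line. *)
Lemma yh_sub3_absorb m a : (m < d)%N -> yh_sub 3 a ->
  exists c, a * (pp 0 m * hecke_sum 0) = c *: (pp 0 m * hecke_sum 0).
Proof.
move=> md; elim=> [|b i lt_in _ [c IH]|b i lt_in _ [c IH]||k b1 b2 _ [c1 IH1] _ [c2 IH2]].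
- by exists 1; rewrite mul1r scale1r.
- exists (u * c); rewrite -hecke_sum_tri_comm -mulrA.
  have -> : g i * (hecke_sum 0 * pp 0 m) = u *: (hecke_sum 0 * pp 0 m).
    by case: i lt_in => [|[|//]] _; [apply: hecke_sum_tri_g | apply: hecke_sum_tri_g1].
  by rewrite -scalerAr hecke_sum_tri_comm IH scalerA.
- exists (w ^+ m * c); rewrite -mulrA [t i * _]mulrA -(add0n i) t_tri_idem //.
  by rewrite -scalerAl -scalerAr IH scalerA.
- by exists 0; rewrite mul0r scale0r.
- by exists (k * c1 + c2); rewrite mulrDl -scalerAl IH1 IH2 scalerA -scalerDl.
Qed.

(** The double sum factors as d^2 e_i e_{i+1}; in the product of the two spectral expansions only a
    common eigenvalue on all three strands survives. *)
Lemma frame_sumE i : frame_sum i = d%:R ^+ 2 *: \sum_(m < d) pp i m.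
Proof.
have -> : frame_sum i = d%:R ^+ 2 *: (frame_idem i * frame_idem i.+1).
  rewrite -scalerAl -scalerAr !scalerA expr2 mulfK // divff // scale1r.
  rewrite big_distrlr; apply: eq_bigr => a _; apply: eq_bigr => b _.
  (* Subtraction is truncated, so the bound on [a] enters here. *)
  have -> : (b + d - a = d - a + b)%N by have := ltn_ord a; lia.
  by rewrite exprD /= !mulrA.
congr (_ *: _); rewrite [frame_idem i.+1]frame_idemE mulr_sumr; apply: eq_bigr => m _.
rewrite frame_idemE mulr_suml (bigD1 m) //= big1 => [|k km].
  by rewrite addr0 mulrA -[_ * eps i.+1 m]mulrA char_idemK.
rewrite mulrA -[_ * eps i.+1 m]mulrA char_idem_orth //.
by rewrite (_ : (k == m :> nat) = false) ?scale0r ?mulr0 ?mul0r //; apply: negbTE.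
Qed.

(** This recovers a single spectral component from an element of the ideal. *)
Lemma tri_idem_frame_sum i m : (m < d)%N -> pp i m * frame_sum i = d%:R ^+ 2 *: pp i m.
Proof.
move=> md; rewrite frame_sumE -scalerAr mulr_sumr (bigD1 (Ordinal md)) //= big1 => [|k km].
  by rewrite addr0 tri_idemK.
rewrite (tri_idemE i m) -[_ * pp i k]mulrA /tri_idem [eps i m * _]mulrA [eps i m * (_ * _)]mulrA char_idem_orth //.
rewrite (_ : (m == k :> nat) = false) ?scale0r ?mul0r ?mulr0 //.
by rewrite eq_sym; apply: negbTE.
Qed.

(* Conjugation by [shift_elt i] moves [g i], [g i.+1] and [t i], ..., [t i.+2] one index up. *)
Definition shift_elt (i : nat) : A := g i * g i.+1 * g i.+2.

Lemma shift_elt_g i : shift_elt i * g i = g i.+1 * shift_elt i.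
Proof.
rewrite /shift_elt -!mulrA -(yh_gg YH (leqnn i.+2)) [g i.+1 * (g i * _)]mulrA.
by rewrite [g i * _]mulrA -(yh_braid YH) -!mulrA.
Qed.

Lemma shift_elt_g1 i : shift_elt i * g i.+1 = g i.+2 * shift_elt i.
Proof.
rewrite /shift_elt -!mulrA -(yh_braid YH) [g i * (g i.+2 * _)]mulrA.
by rewrite (yh_gg YH (leqnn i.+2)) -!mulrA.
Qed.

Lemma shift_elt_t i k : (k < 3)%N -> shift_elt i * t (i + k) = t (i + k).+1 * shift_elt i.
Proof.
have far j l : (j.+1 < l)%N || (l < j)%N -> g j * t l = t l * g j.
  by move=> jl; apply: (yh_gt3 YH); lia.
case: k => [|[|[|//]]] _; rewrite ?addn0 ?addn1 ?addn2 /shift_elt -!mulrA.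
- by rewrite !far ?(mulrA (g i.+1)) ?far ?mulrA ?(yh_gt1 YH) //; lia.
- rewrite far; last lia.
  by rewrite (mulrA (g i.+1)) (yh_gt1 YH) -mulrA mulrA far ?mulrA //; lia.
- rewrite (yh_gt1 YH) (mulrA (g i.+1)) far; last lia.
  by rewrite -mulrA mulrA far ?mulrA //; lia.
Qed.

Lemma shift_elt_ftl i : shift_elt i * ftl_elt i = ftl_elt i.+1 * shift_elt i.
Proof.
set s := shift_elt i.
have st k p : (k < 3)%N -> s * t (i + k) ^+ p = t (i + k).+1 ^+ p * s.
  by move=> k3; apply/exp_intertwine/shift_elt_t.
have comm2 (a b a' b' : A) : s * a = a' * s -> s * b = b' * s -> s * (a * b) = a' * b' * s.
  by move=> sa sb; rewrite mulrA sa -mulrA sb mulrA.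
have sg := shift_elt_g i; have sg1 := shift_elt_g1 i.
apply: (comm2); last first.
  rewrite /hecke_sum !mulrDr !mulrDl mulr1 mul1r.
  by do !congr (_ + _) => //; do ?apply: (comm2).
rewrite mulr_sumr mulr_suml; apply: eq_bigr => a _.
rewrite mulr_sumr mulr_suml; apply: eq_bigr => b _.
have := st 0%N a isT; have := st 1%N (b + d - a)%N isT; have := st 2%N (d - b)%N isT.
by rewrite addn0 addn1 addn2 => st2 st1 st0; do 2?apply: (comm2).
Qed.

Definition shift_inv (i : nat) : A := yh_inv i.+2 * yh_inv i.+1 * yh_inv i.

Lemma shift_eltV i : shift_elt i * shift_inv i = 1.
Proof.
rewrite /shift_elt /shift_inv -!mulrA [g i.+2 * _]mulrA yh_mulgV mul1r.
by rewrite [g i.+1 * _]mulrA yh_mulgV mul1r yh_mulgV.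
Qed.

Lemma shift_elt_sub n i : (i.+3 < n)%N -> yh_sub n (shift_elt i).
Proof.
by move=> lt_in; do 2?apply: yh_subM; apply: yh_subG => //; do 2?apply: ltnW => //; lia.
Qed.

Lemma shift_inv_sub n i : (i.+3 < n)%N -> yh_sub n (shift_inv i).
Proof. by move=> lt_in; do 2?apply: yh_subM; apply: yh_inv_sub; lia. Qed.

Lemma ftl_elt_conj i : ftl_elt i.+1 = shift_elt i * ftl_elt i * shift_inv i.
Proof. by rewrite shift_elt_ftl -mulrA shift_eltV mulr1. Qed.

(** * The Markov trace on the ideal *)

Variables (tr : {scalar A}) (z : F) (x : nat -> F).

(** The framing rule starts at [t 1]. It includes s = 0, which for positive d forces [x 0] to be
    1. *)
Record markov_trace : Prop := MarkovTrace {
  mtr1 : tr 1 = 1;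
  mtrC : forall a b, tr (a * b) = tr (b * a);
  mtr_g : forall n a, yh_sub n.+1 a -> tr (a * g n) = z * tr a;
  mtr_t : forall n a s, yh_sub n.+1 a -> (s < d)%N -> tr (a * t n.+1 ^+ s) = x s * tr a }.

Hypothesis TR : markov_trace.

Definition fourier_coef (m : nat) : F := d%:R^-1 * \sum_(s < d) x s / w ^+ (s * m).

Local Notation y := fourier_coef.

Lemma tr_char_idem n a m : yh_sub n.+1 a -> tr (a * eps n.+1 m) = y m * tr a.
Proof.
move=> Ya; rewrite /eps -scalerAr linearZ /= /y -mulrA; congr (_ * _).
rewrite mulr_sumr linear_sum mulr_suml; apply: eq_bigr => s _.
by rewrite -scalerAr linearZ /= (mtr_t TR) // mulnC mulrA [x s / _]mulrC.
Qed.

(** The framing rule does not reach index 0, but conjugation by [g 0] carries [eps 0 m] to [eps 1 m]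
    and preserves the trace. *)
Lemma tr_char_idem0 m : tr (eps 0 m) = y m.
Proof.
have := tr_char_idem m (yh_sub1 1); rewrite (mtr1 TR) mulr1 mul1r => <-.
rewrite -[eps 1 m]mulr1 -(yh_mulgV 0) mulrA -(char_idem_intertwine m (yh_gt1 YH 0)).
by rewrite (mtrC TR) mulrA yh_mulVg mul1r.
Qed.

Lemma tr_char_idem01 m : tr (eps 0 m * eps 1 m) = y m ^+ 2.
Proof. by rewrite tr_char_idem ?tr_char_idem0 //; apply: char_idem_sub. Qed.

(** Crossing [g 0] turns [eps 1 m] into a second [eps 0 m]; cyclicity brings the two copies together
    and idempotence merges them. *)
Lemma tr_char_idem01_g m : (m < d)%N -> tr (eps 0 m * eps 1 m * g 0) = z * y m.
Proof.
move=> md; rewrite -mulrA -(char_idem_intertwine m (yh_gt1 YH 0)) mulrA (mtrC TR) mulrA.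
by rewrite char_idemK // (mtr_g TR) ?tr_char_idem0 //; apply: char_idem_sub.
Qed.

(** The same absorption one strand up: [eps 2 m] crosses [g 1], becomes [eps 1 m] and is merged
    cyclically, while the Markov rule removes [g 1]. *)
Lemma tr_tri_idem_g1 m a : (m < d)%N -> yh_sub 2 a ->
  tr (a * pp 0 m * g 1) = z * tr (a * (eps 0 m * eps 1 m)).
Proof.
move=> md Ya; have Y0 : yh_sub 2 (eps 0 m) by apply: char_idem_sub.
have Y1 : yh_sub 2 (eps 1 m) by apply: char_idem_sub.
have -> : a * pp 0 m * g 1 = a * (eps 0 m * eps 1 m) * g 1 * eps 1 m.
  by rewrite /tri_idem -!mulrA (char_idem_intertwine m (yh_gt1 YH 1)).
rewrite (mtrC TR) [eps 1 m * _]mulrA (mtr_g TR); last by do 3?apply: yh_subM.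
by congr (_ * _); rewrite (mtrC TR) -!mulrA char_idemK.
Qed.

Lemma tr_tri_hecke m : (m < d)%N ->
  tr (pp 0 m * hecke_sum 0) = y m * (y m + z) * (y m + (u + 1) * z).
Proof.
move=> md; set p := pp 0 m.
have Y01 : yh_sub 2 (eps 0 m * eps 1 m) by apply: yh_subM; apply: char_idem_sub.
have Yg : yh_sub 2 (g 0) by apply: yh_subG.
have tr_p : tr p = y m ^+ 3 by rewrite tr_char_idem // tr_char_idem01 -exprS.
have tr_g0 : tr (p * g 0) = z * y m ^+ 2.
  have g0t2 : g 0 * t 2 = t 2 * g 0 by apply: (yh_gt3 YH).
  rewrite /p /tri_idem -mulrA -(char_idem_intertwine m g0t2) mulrA.
  by rewrite tr_char_idem ?tr_char_idem01_g //; [ring | apply: yh_subM].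
have tr_g1 : tr (p * g 1) = z * y m ^+ 2.
  by rewrite -[p]mul1r tr_tri_idem_g1 ?mul1r ?tr_char_idem01 //; apply: yh_sub1.
have tr_gpg : tr (g 0 * p * g 1) = z ^+ 2 * y m.
  by rewrite tr_tri_idem_g1 // (mtrC TR) tr_char_idem01_g //; ring.
have tr_g01 : tr (p * (g 0 * g 1)) = z ^+ 2 * y m.
  by rewrite mulrA -tri_idem_commG.
have tr_g10 : tr (p * (g 1 * g 0)) = z ^+ 2 * y m.
  by rewrite mulrA (mtrC TR) mulrA.
have tr_g010 : tr (p * (g 0 * g 1 * g 0)) = u * (z * y m ^+ 2) + (u - 1) * (z ^+ 2 * y m).
  (* Cyclicity joins the two outer letters into the square of [g 0], to which the quadratic relation
     applies. *)
  have -> : tr (p * (g 0 * g 1 * g 0)) = tr (g 0 * g 0 * p * g 1).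
    by rewrite !mulrA -[p * g 0]tri_idem_commG (mtrC TR) !mulrA.
  move: (frame_idem_tri 0 md) (yh_quad YH 0); move: (frame_idem 0) => f fp ->.
  rewrite !mulrDl mul1r -!scalerAl -[f * g 0 * p]mulrA tri_idem_commG mulrA fp.
  by rewrite -tri_idem_commG !linearD !linearZ /= tr_g1 tr_gpg; ring.
rewrite /hecke_sum !mulrDr mulr1 !linearD /= tr_p tr_g0 tr_g1 tr_g01 tr_g10 tr_g010; ring.
Qed.

Lemma tX_mod i s : t i ^+ s = t i ^+ (s %% d).
Proof. by rewrite {1}(divn_eq s d) exprD mulnC exprM (yh_td YH) expr1n mul1r. Qed.

(** For n = 3 each multiple of the element is a scalar multiple of it. Beyond that, the spanning of
    Y_{n+1} leaves a power of [t n] or one top letter [g k], which the trace rules strip off. *)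
Lemma tr_tri_hecke_vanish m n a : (m < d)%N -> tr (pp 0 m * hecke_sum 0) = 0 ->
  (3 <= n)%N -> yh_sub n a -> tr (a * (pp 0 m * hecke_sum 0)) = 0.
Proof.
move=> md q0; set q := pp 0 m * hecke_sum 0 in q0 *.
have Yq n' : (3 <= n')%N -> yh_sub n' q.
  by move=> n3; apply: yh_subM; [apply: tri_idem_sub | apply: hecke_sum_sub].
elim: n a => // n IH a; rewrite leq_eqVlt => /orP[/eqP [<-]|n3] Ya.
  by have [c ->] := yh_sub3_absorb md Ya; rewrite linearZ /= q0 mulr0.
move: a Ya; apply: (@yh_sub_span n (fun a => tr (a * q) = 0)).
- by rewrite mul0r linear0.
- by move=> c a b a0 b0; rewrite mulrDl -scalerAl linearD linearZ /= a0 b0 mulr0 addr0.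
- move=> a s Ya; rewrite -mulrA -(yh_sub_commTX _ (Yq _ n3)) mulrA tX_mod.
  have IHa := IH a n3 Ya; case: n n3 Ya {IH} IHa => // n n3 Ya IHa; rewrite (mtr_t TR) ?IHa ?mulr0 //.
    by apply: yh_subM => //; apply: Yq.
  exact/ltn_pmod/(prim_order_gt0 w_prim).
(* Cyclicity moves [g k] to the end, where the Markov rule removes it, and then brings what remains
   back to the form [a * b * q]. *)
- move=> k a b nk Ya Yb; have Ybqa : yh_sub n (b * q * a).
    by do 2?apply: yh_subM => //; apply: Yq.
  rewrite nk in Ybqa IH n3 Ya Yb.
  rewrite -[_ * b * q]mulrA (mtrC TR) [b * q * _]mulrA (mtr_g TR) //.
  rewrite (mtrC TR) mulrA IH ?mulr0 //.
  exact: yh_subM.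
Qed.

Theorem markov_trace_ftl n : (3 <= n)%N ->
  (forall i a b, (i.+2 < n)%N -> yh_sub n a -> yh_sub n b -> tr (a * ftl_elt i * b) = 0)
  <-> (forall m, (m < d)%N -> y m * (y m + z) * (y m + (u + 1) * z) = 0).
Proof.
move=> n3; split=> [ftl0 m md | y0].
  (* The left factor [tri_idem 0 m] isolates the m-th component, up to the nonzero scalar d^2. *)
  have := ftl0 0%N _ _ n3 (tri_idem_sub m n3) (yh_sub1 n).
  rewrite mulr1 mulrA tri_idem_frame_sum // -scalerAl linearZ /= tr_tri_hecke // => /eqP.
  by rewrite mulf_eq0 expf_eq0 /= (negbTE d_neq0) => /eqP.
have ftl0 i a : (i.+2 < n)%N -> yh_sub n a -> tr (a * ftl_elt i) = 0.
  elim: i a => [|i IH] a lt_in Ya.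
    rewrite /ftl_elt frame_sumE -scalerAl -scalerAr linearZ /= mulr_suml mulr_sumr linear_sum.
    rewrite big1 ?mulr0 // => m _; apply: (@tr_tri_hecke_vanish _ n) => //.
    by rewrite tr_tri_hecke ?y0.
  (* Conjugation lowers the index by one; the conjugating elements are absorbed into the arbitrary
     factor since they lie in [yh_sub n]. *)
  rewrite ftl_elt_conj mulrA (mtrC TR) [a * (_ * _)]mulrA [shift_inv i * _]mulrA.
  apply: IH; first exact: ltnW.
  by apply: yh_subM; [apply: shift_inv_sub | apply: yh_subM => //; apply: shift_elt_sub].
by move=> i a b lt_in Ya Yb; rewrite (mtrC TR) mulrA; apply: ftl0 => //; apply: yh_subM.
Qed.

End YokonumaHecke.

(** * Finite Fourier analysis *)

Section FourierSupport.

Variables (F : fieldType) (d : nat) (w : F) (x : nat -> F).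
Hypotheses (w_prim : d.-primitive_root w) (d_neq0 : d%:R != 0 :> F).

Local Notation y := (fourier_coef d w x).

Lemma fourier_inversion (k : 'I_d) : x k = \sum_(m < d) y m * w ^+ (k * m).
Proof.
rewrite /fourier_coef; under eq_bigr => m _ do rewrite -mulrA mulr_suml.
rewrite -mulr_sumr exchange_big (bigD1 k) //= [X in _ + X]big1 => [|s sk].
  under eq_bigr => m _ do rewrite mulfVK ?expf_neq0 ?(primitive_root_neq0 w_prim) //.
  by rewrite addr0 sumr_const card_ord -[x k *+ d]mulr_natl mulKf.
under eq_bigr => m _ do rewrite -mulrA [_^-1 * _]mulrC.
rewrite -mulr_sumr (prim_root_orthogonality w_prim) //.
by rewrite (_ : (k == s :> nat) = false) ?mul0r ?mulr0 // eq_sym; apply: negbTE.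
Qed.

(** Uniqueness of the Fourier expansion, by orthogonality in the exponent [k]. *)
Lemma fourier_coef_sum (c : 'I_d -> F) (m : 'I_d) :
  (forall k : 'I_d, x k = \sum_j c j * w ^+ (k * j)) -> y m = c m.
Proof.
move=> xE; rewrite /fourier_coef; under eq_bigr => s _ do rewrite xE mulr_suml.
rewrite exchange_big (bigD1 m) //= [X in _ + X]big1 => [|j jm].
  under eq_bigr => s _ do rewrite mulfK ?expf_neq0 ?(primitive_root_neq0 w_prim) //.
  by rewrite addr0 sumr_const card_ord -[c m *+ d]mulr_natl mulKf.
under eq_bigr => s _ do rewrite -mulrA ![(s * _)%N]mulnC.
rewrite -mulr_sumr (prim_root_orthogonality w_prim) //.
by rewrite (_ : (j == m :> nat) = false) ?mul0r ?mulr0 //; apply: negbTE.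
Qed.

Lemma fourier_support (u z : F) : x 0%N = 1 ->
  (forall m, (m < d)%N -> y m * (y m + z) * (y m + (u + 1) * z) = 0) <->
  exists S1 S2 : {set 'I_d},
    [/\ [disjoint S1 & S2],
        S1 :|: S2 = [set m : 'I_d | \sum_(k < d) x k / w ^+ (k * m) != 0],
        (forall k : 'I_d, x k = - z * (\sum_(m in S1) w ^+ (k * m)
                                       + (u + 1) * \sum_(m in S2) w ^+ (k * m))),
        #|S1|%:R + (u + 1) * #|S2|%:R != 0 &
        z = - (#|S1|%:R + (u + 1) * #|S2|%:R)^-1].
Proof.
move=> x0; split=> [y0 | [S1 [S2 [dis _ xE _ _]]] m md]; last first.
  (* By uniqueness of the expansion, membership in [S1] or [S2] determines the coefficient: -z,
     -(u+1)z or 0. *)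
  have -> : y m = - z * ((Ordinal md \in S1)%:R + (u + 1) * (Ordinal md \in S2)%:R).
    apply: (@fourier_coef_sum (fun j => - z * ((j \in S1)%:R + (u + 1) * (j \in S2)%:R))
      (Ordinal md)) => k.
    rewrite xE !(big_mkcond (fun j => j \in _)) !mulr_sumr -big_split mulr_sumr /=.
    apply: eq_bigr => j _; rewrite -mulrA mulrDl; congr (_ * _).
    by case: (j \in S1); case: (j \in S2) => /=; ring.
  case: (boolP (_ \in S1)) => [m1|_]; last by case: (_ \in S2) => /=; ring.
  by rewrite (disjointFr dis m1) /=; ring.
pose S1 := [set m : 'I_d | (y m != 0) && (y m == - z)].
(* Defined by exclusion, so that disjointness holds even if the values -z and -(u+1)z coincide; on
   [S2] the cubic equation leaves only -(u+1)z. *)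
pose S2 := [set m : 'I_d | (y m != 0) && (y m != - z)].
have xE (k : 'I_d) : x k = - z * (\sum_(m in S1) w ^+ (k * m)
                                  + (u + 1) * \sum_(m in S2) w ^+ (k * m)).
  rewrite fourier_inversion !(big_mkcond (fun j => j \in _)) !mulr_sumr -big_split mulr_sumr /=.
  apply: eq_bigr => m _; rewrite !inE.
  have [->|ym0] /= := eqVneq (y m) 0; first by ring.
  have [->|ymz] /= := eqVneq (y m) (- z); first by ring.
  have /eqP := y0 m (ltn_ord m); rewrite mulf_eq0 mulf_eq0 (negbTE ym0) addr_eq0 (negbTE ymz) /=.
  by rewrite addr_eq0 => /eqP ->; ring.
(* The expansion at k = 0, where [x 0] is 1, yields both the value of [z] and a nonzero
   denominator. *)
have dz : - z * (#|S1|%:R + (u + 1) * #|S2|%:R) = 1.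
  have d0 := prim_order_gt0 w_prim.
  have sum1 (S : {set 'I_d}) : \sum_(m in S) w ^+ (0 * m) = #|S|%:R.
    by under eq_bigr => m _ do rewrite mul0n expr0; rewrite sumr_const.
  by rewrite -[RHS]x0 (xE (Ordinal d0)) /= !sum1.
have D0 : #|S1|%:R + (u + 1) * #|S2|%:R != 0.
  by apply: contra_eq_neq dz => ->; rewrite mulr0 eq_sym oner_eq0.
exists S1, S2; split=> //.
- rewrite disjoint_subset; apply/subsetP => m; rewrite !inE => /andP[-> /eqP ->].
  by rewrite eqxx.
- apply/setP => m; rewrite !inE -andb_orr orbN andbT /fourier_coef mulf_eq0 invr_eq0.
  by rewrite (negbTE d_neq0).
- by apply: (mulIf D0); rewrite mulNr mulVf //; apply: oppr_inj; rewrite -mulNr dz opprK.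
Qed.

End FourierSupport.

(** * The complex primitive root of unity *)

Local Open Scope complex_scope.

Lemma cisX (R : realType) (th : R) (k : nat) :
  (cos th +i* sin th) ^+ k = cos (th * k%:R) +i* sin (th * k%:R).
Proof.
elim: k => [|k IH]; first by rewrite mulr0 cos0 sin0.
rewrite exprS {}IH mulrS mulrDr mulr1 trigo.cosD trigo.sinD.
by apply/eqP; rewrite eq_complex /=; apply/andP; split; apply/eqP; ring.
Qed.

(** A smaller power equal to 1 would give an angle a with cos a = 1 and 0 < a/2 < pi, contradicting
    cos a = 1 - 2 sin^2(a/2) < 1. *)
Lemma cis_primitive_root (R : realType) (d : nat) : (0 < d)%N ->
  d.-primitive_root (cos (2 * pi / d%:R : R) +i* sin (2 * pi / d%:R : R)).
Proof.
move=> d0; have dN0 : d%:R != 0 :> R by rewrite pnatr_eq0 -lt0n.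
have pi0 := @pi_gt0 R.
apply/andP; split=> //; apply/forallP => i; apply/eqP; rewrite unity_rootE cisX.
have [->|ne] := eqVneq i.+1 d.
  by rewrite divfK // [2 * pi]mulrC mulr_natr cos2pi sin2pi eqxx.
have lt_id : (i.+1 < d)%N by rewrite ltn_neqAle ne ltn_ord.
apply/negbTE/eqP => /(congr1 (@complex.Re _)) /=.
set a := _ * i.+1%:R => cos1.
have a0 : 0 < a / 2 by rewrite /a; do ?[apply: divr_gt0 | apply: mulr_gt0]; rewrite ?ltr0n.
have api : a / 2 < pi.
  have -> : a / 2 = pi * (i.+1%:R / d%:R) by rewrite /a; field.
  by rewrite gtr_pMr // ltr_pdivrMr ?ltr0n // mul1r ltr_nat.
have s0 : 0 < sin (a / 2) by apply: sin_gt0_pi; rewrite a0.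
have aE : a = a / 2 + a / 2 by field.
move: cos1; rewrite aE trigo.cosD; have := cos2Dsin2 (a / 2); nra.
Qed.

Lemma omega_primitive (d : nat) : (0 < d)%N -> d.-primitive_root (omega d).
Proof. exact: cis_primitive_root. Qed.

Lemma natC_neq0 (d : nat) : (0 < d)%N -> d%:R != 0 :> C.
Proof. by move=> d0; rewrite (pnatr_eq0 (Rdefinitions.R[i])) -lt0n. Qed.

Local Close Scope complex_scope.

(** * The algebra of words modulo the radical of a functional *)

Lemma ev_ext (f h : word -> C) (c : comb) : f =1 h -> ev f c = ev h c.
Proof. by move=> fh; apply: eq_bigr => p _; rewrite fh. Qed.

Lemma ev_add f a b : ev f (cadd a b) = ev f a + ev f b.
Proof. by rewrite /ev big_cat. Qed.

Lemma ev_scale f k a : ev f (cscale k a) = k * ev f a.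
Proof. by rewrite /ev big_map mulr_sumr; apply: eq_bigr => p _; rewrite /= mulrA. Qed.

Lemma ev_cw f v : ev f (cw v) = f v.
Proof. by rewrite /ev big_seq1 mul1r. Qed.

Lemma ev_mul f a b : ev f (cmul a b) = ev (fun v => ev (fun v' => f (v ++ v')) b) a.
Proof.
rewrite /ev big_allpairs_dep; apply: eq_bigr => p _.
by rewrite mulr_sumr; apply: eq_bigr => q _; rewrite /= mulrA.
Qed.

Lemma ev_swap (f : word -> word -> C) a b :
  ev (fun v => ev (f v) b) a = ev (fun v => ev (f^~ v) a) b.
Proof.
rewrite /ev; under eq_bigr => p _ do rewrite mulr_sumr.
rewrite exchange_big; apply: eq_bigr => q _; rewrite mulr_sumr.
by apply: eq_bigr => p _; rewrite mulrCA.
Qed.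

(** The encoding gives letters a choice structure, inherited by combinations of words; the quotient
    needs it to select representatives. *)
Definition letter_code (l : letter) : nat + nat :=
  match l with Gl i => inl i | Tl i => inr i end.
Definition letter_decode (c : nat + nat) : letter :=
  match c with inl i => Gl i | inr i => Tl i end.
Lemma letter_codeK : cancel letter_code letter_decode. Proof. by case. Qed.
HB.instance Definition _ := Choice.copy letter (can_type letter_codeK).

Section Quotient.

Variable T : word -> C.

(** Vanishing of [ctx l r c] for all [l] and [r] says that the two-sided ideal generated by [c] lies
    in the kernel of [T]. *)
Definition ctx (l r : word) (c : comb) : C := ev (fun v => T (l ++ v ++ r)) c.

Definition ctx_eq (a b : comb) : bool := `[< forall l r, ctx l r a = ctx l r b >].

Lemma ctx_eq_equiv : equiv_class_of ctx_eq.
Proof.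
split=> [a|a b|b a c].
- exact/asboolP.
- by apply/asboolP/asboolP => H l r; rewrite H.
- by move=> /asboolP ab /asboolP bc; apply/asboolP => l r; rewrite ab bc.
Qed.

Canonical ctx_eq_rel := EquivRelPack ctx_eq_equiv.

Lemma ctx_mull l r a b : ctx l r (cmul a b) = ev (fun v => ctx (l ++ v) r b) a.
Proof. by rewrite /ctx ev_mul; apply: ev_ext => v; apply: ev_ext => v'; rewrite !catA. Qed.

Lemma ctx_mulr l r a b : ctx l r (cmul a b) = ev (fun v => ctx l (v ++ r) a) b.
Proof.
rewrite /ctx ev_mul ev_swap; apply: ev_ext => v; apply: ev_ext => v'.
by rewrite !catA.
Qed.

(* The quotient by the largest two-sided ideal on which [T] vanishes; the unused
   argument [T1] is what makes this ring nontrivial. *)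
Definition word_alg (T1 : T [::] = 1) : Type := {eq_quot ctx_eq}%qT.

End Quotient.

Section WordAlgebra.

Variables (T : word -> C) (T1 : T [::] = 1).

Local Notation A := (word_alg T1).

HB.instance Definition _ := Choice.on A.

Definition cls (c : comb) : A := (\pi_({eq_quot (ctx_eq T)}) c)%qT.
Definition rep (a : A) : comb := repr (a : {eq_quot (ctx_eq T)}%qT).

Lemma repK : cancel rep cls. Proof. exact: reprK. Qed.

Lemma clsP a b : cls a = cls b <-> forall l r, ctx T l r a = ctx T l r b.
Proof. by split=> [/eqmodP/asboolP | H]; last apply/eqmodP/asboolP. Qed.

Lemma ctx_rep c l r : ctx T l r (rep (cls c)) = ctx T l r c.
Proof. by have /clsP := repK (cls c); apply. Qed.

Definition qadd (a b : A) := cls (cadd (rep a) (rep b)).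
Definition qopp (a : A) := cls (copp (rep a)).
Definition qscale (k : C) (a : A) := cls (cscale k (rep a)).
Definition qmul (a b : A) := cls (cmul (rep a) (rep b)).

Lemma ctx_add l r a b : ctx T l r (cadd a b) = ctx T l r a + ctx T l r b.
Proof. exact: ev_add. Qed.

Lemma ctx_scale l r k a : ctx T l r (cscale k a) = k * ctx T l r a.
Proof. exact: ev_scale. Qed.

Lemma qaddE a b : qadd (cls a) (cls b) = cls (cadd a b).
Proof. by apply/clsP => l r; rewrite !ctx_add !ctx_rep. Qed.

Lemma qscaleE k a : qscale k (cls a) = cls (cscale k a).
Proof. by apply/clsP => l r; rewrite !ctx_scale !ctx_rep. Qed.

Lemma qoppE a : qopp (cls a) = cls (copp a).
Proof. exact: qscaleE. Qed.

(** The representatives are replaced one factor at a time, the other factor being absorbed into the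
    context. *)
Lemma qmulE a b : qmul (cls a) (cls b) = cls (cmul a b).
Proof.
apply/clsP => l r; rewrite ctx_mulr.
under ev_ext => v do rewrite ctx_rep.
by rewrite -ctx_mulr !ctx_mull; apply: ev_ext => v; rewrite ctx_rep.
Qed.

Lemma clsW (P : A -> Prop) : (forall c, P (cls c)) -> forall a, P a.
Proof. by move=> Pc a; rewrite -[a]repK. Qed.

Lemma qaddA : associative qadd.
Proof.
elim/clsW=> a; elim/clsW=> b; elim/clsW=> c; rewrite !qaddE.
by apply/clsP => l r; rewrite !ctx_add addrA.
Qed.

Lemma qaddC : commutative qadd.
Proof.
elim/clsW=> a; elim/clsW=> b; rewrite !qaddE.
by apply/clsP => l r; rewrite !ctx_add addrC.
Qed.

Lemma qadd0 : left_id (cls [::]) qadd.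
Proof. by elim/clsW=> a; rewrite qaddE. Qed.

Lemma qaddN : left_inverse (cls [::]) qopp qadd.
Proof.
elim/clsW=> a; rewrite qoppE qaddE; apply/clsP => l r.
by rewrite ctx_add ctx_scale mulN1r addNr /ctx /ev big_nil.
Qed.

HB.instance Definition _ := GRing.isZmodule.Build A qaddA qaddC qadd0 qaddN.

Lemma qmulA : associative qmul.
Proof.
elim/clsW=> a; elim/clsW=> b; elim/clsW=> c; rewrite !qmulE.
apply/clsP => l r; rewrite !ctx_mull ev_mul; apply: ev_ext => v.
by rewrite ctx_mull; apply: ev_ext => v'; rewrite catA.
Qed.

Lemma qmul1l : left_id (cls cone) qmul.
Proof. by elim/clsW=> a; rewrite qmulE; apply/clsP => l r; rewrite ctx_mull ev_cw cats0. Qed.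

Lemma qmul1r : right_id (cls cone) qmul.
Proof. by elim/clsW=> a; rewrite qmulE; apply/clsP => l r; rewrite ctx_mulr ev_cw. Qed.

Lemma qmulDl : left_distributive qmul qadd.
Proof.
elim/clsW=> a; elim/clsW=> b; elim/clsW=> c; rewrite !(qmulE, qaddE).
by apply/clsP => l r; rewrite ctx_add !ctx_mull ev_add.
Qed.

Lemma qmulDr : right_distributive qmul qadd.
Proof.
elim/clsW=> a; elim/clsW=> b; elim/clsW=> c; rewrite !(qmulE, qaddE).
by apply/clsP => l r; rewrite ctx_add !ctx_mulr ev_add.
Qed.

Lemma cone_neq0 : cls cone != cls [::].
Proof.
apply/eqP => /clsP /(_ [::] [::]); rewrite {1}/ctx ev_cw T1 /ctx /ev big_nil.
by move/eqP; rewrite oner_eq0.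
Qed.

HB.instance Definition _ :=
  GRing.Zmodule_isNzRing.Build A qmulA qmul1l qmul1r qmulDl qmulDr cone_neq0.

Lemma qscaleA k k' a : qscale k (qscale k' a) = qscale (k * k') a.
Proof.
by elim/clsW: a => a; rewrite !qscaleE; apply/clsP => l r; rewrite !ctx_scale mulrA.
Qed.

Lemma qscale1 : left_id 1 qscale.
Proof. by elim/clsW=> a; rewrite qscaleE; apply/clsP => l r; rewrite ctx_scale mul1r. Qed.

Lemma qscaleDr : right_distributive qscale qadd.
Proof.
move=> k; elim/clsW=> a; elim/clsW=> b; rewrite !(qscaleE, qaddE).
by apply/clsP => l r; rewrite !(ctx_scale, ctx_add) mulrDr.
Qed.

Lemma qscaleDl a : {morph qscale^~ a : k k' / k + k' >-> qadd k k'}.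
Proof.
elim/clsW: a => a k k'; rewrite !(qscaleE, qaddE).
by apply/clsP => l r; rewrite !(ctx_scale, ctx_add) mulrDl.
Qed.

HB.instance Definition _ :=
  GRing.Zmodule_isLmodule.Build C A qscaleA qscale1 qscaleDr qscaleDl.

Lemma qscaleAl k (a b : A) : k *: (a * b) = k *: a * b.
Proof.
elim/clsW: a => a; elim/clsW: b => b.
rewrite /GRing.scale /GRing.mul /= !(qmulE, qscaleE).
by apply/clsP => l r; rewrite !(ctx_scale, ctx_mull) ev_scale.
Qed.

HB.instance Definition _ := GRing.Lmodule_isLalgebra.Build C A qscaleAl.

Lemma qscaleAr k (a b : A) : k *: (a * b) = a * (k *: b).
Proof.
elim/clsW: a => a; elim/clsW: b => b.
rewrite /GRing.scale /GRing.mul /= !(qmulE, qscaleE).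
by apply/clsP => l r; rewrite !(ctx_scale, ctx_mulr) ev_scale.
Qed.

HB.instance Definition _ := GRing.Lalgebra_isAlgebra.Build C A qscaleAr.

Definition word_tr (a : A) : C := ctx T [::] [::] (rep a).

Lemma word_tr_cls c : word_tr (cls c) = ev T c.
Proof. by rewrite /word_tr ctx_rep /ctx; apply: ev_ext => v; rewrite cats0. Qed.

Lemma clsD a b : cls (cadd a b) = cls a + cls b.
Proof. by rewrite -qaddE. Qed.

Lemma clsZ k a : cls (cscale k a) = k *: cls a.
Proof. by rewrite -qscaleE. Qed.

Lemma clsN a : cls (copp a) = - cls a.
Proof. by rewrite clsZ scaleN1r. Qed.

Lemma clsM a b : cls (cmul a b) = cls a * cls b.
Proof. by rewrite -qmulE. Qed.

Lemma cls_sum (s : seq comb) : cls (csum s) = \sum_(c <- s) cls c.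
Proof. by elim: s => [|c s IH]; rewrite ?big_nil ?big_cons // -IH -clsD. Qed.

Lemma word_tr_linear : linear_for *%R word_tr.
Proof.
move=> k; elim/clsW=> a; elim/clsW=> b.
by rewrite -clsZ -clsD !word_tr_cls ev_add ev_scale.
Qed.

HB.instance Definition _ := GRing.isLinear.Build C A C *%R word_tr word_tr_linear.

End WordAlgebra.

(** * From words to the algebra *)

(** Passes from the 0-based letters of the algebra to the 1-based ones of the statement, so that
    index 0, which has no relations there, never occurs and the algebra relations hold for all
    indices. *)
Definition shift_letter (l : letter) : letter :=
  match l with Gl i => Gl i.+1 | Tl i => Tl i.+1 end.

Definition cshift (c : comb) : comb := [seq (p.1, map shift_letter p.2) | p <- c].

Lemma cshift_add a b : cshift (cadd a b) = cadd (cshift a) (cshift b).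
Proof. exact: map_cat. Qed.

Lemma cshift_scale k a : cshift (cscale k a) = cscale k (cshift a).
Proof. by rewrite /cshift /cscale -!map_comp. Qed.

Lemma cshift_mul a b : cshift (cmul a b) = cmul (cshift a) (cshift b).
Proof.
rewrite /cshift /cmul; elim: a => //= p a IH; rewrite map_cat IH -!map_comp.
by congr (_ ++ _); apply: eq_map => q; rewrite /= map_cat.
Qed.

Lemma cshift_sum s : cshift (csum s) = csum (map cshift s).
Proof. exact: map_flatten. Qed.

Lemma cshift_tpow i k : cshift (tpow i k) = tpow i.+1 k.
Proof. by rewrite /cshift /= map_nseq. Qed.

Lemma cshift_e d i : cshift (e_ d i) = e_ d i.+1.
Proof.
rewrite /e_ cshift_scale cshift_sum -map_comp; congr (cscale _ (csum _)).
by apply: eq_map => s; rewrite [LHS]cshift_mul !cshift_tpow.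
Qed.

Lemma cshift_r d i : cshift (r_ d i) = r_ d i.+1.
Proof.
rewrite /r_ cshift_mul cshift_sum map_allpairs; congr (cmul (csum _) _).
congr flatten; apply: eq_map => a; apply: eq_map => b.
by rewrite !cshift_mul !cshift_tpow.
Qed.

Lemma ev_cshift (T : word -> C) c : ev T (cshift c) = ev (T \o map shift_letter) c.
Proof. by rewrite /ev big_map. Qed.

Lemma shift_word_in n v : gen_in n v -> exists v', v = map shift_letter v'.
Proof.
elim: v => [|l v IH] /=; first by exists [::].
case/andP=> ln /IH[v' ->]; case: l ln => [] [|i] //= _.
  by exists (Gl i :: v').
by exists (Tl i :: v').
Qed.

(** The radical ranges over all contexts, while the trace axioms speak of one Y_{d,N} at a time; a
    large enough N accommodates any given words. *)
Lemma gen_in_large v : exists N, forall n, (N <= n)%N -> gen_in n (map shift_letter v).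
Proof.
elim: v => [|l v [N HN]] /=; first by exists 0%N.
case: l => i; exists (maxn N i.+2) => n; rewrite geq_max => /andP[Nn iN] /=;
  rewrite HN // andbT; lia.
Qed.

Lemma sum_iota (V : nmodType) (f : nat -> V) d :
  \sum_(s <- iota 0 d) f s = \sum_(s < d) f s.
Proof. by rewrite -(big_mkord xpredT f) /index_iota subn0. Qed.

Section TraceAlgebra.

Variables (d : nat) (u z : C) (x : nat -> C) (T : word -> C).
Hypothesis TR : is_markov_trace d u z x T.

Local Notation T0 := (T \o map shift_letter).

Lemma T0_nil : T0 [::] = 1. Proof. by case: TR. Qed.

Local Notation A := (word_alg T0_nil).
Local Notation cls := (@cls T0 T0_nil).
Local Notation gA := (fun i => cls (g i)).
Local Notation tA := (fun i => cls (t i)).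
Local Notation tr := (@word_tr T0 T0_nil).

Lemma cls_rel c : YH_rel d u (cshift c) -> cls c = 0.
Proof.
move=> rel; apply/clsP => l r; rewrite [RHS]/ctx /ev big_nil.
have [N1 Hl] := gen_in_large l; have [N2 Hr] := gen_in_large r.
case: TR => /(_ (maxn N1 N2) _ _ _ (Hl _ (leq_maxl _ _)) (Hr _ (leq_maxr _ _)) rel) <- _ _ _ _.
rewrite ev_mul ev_cw ev_mul ev_cshift; apply: ev_ext => v.
by rewrite [RHS]ev_cw /= !map_cat.
Qed.

Lemma cls_rel_sub a b : YH_rel d u (csub (cshift a) (cshift b)) -> cls a = cls b.
Proof.
move=> rel; apply/eqP; rewrite -subr_eq0 -clsN -clsD; apply/eqP/cls_rel.
by rewrite cshift_add cshift_scale.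
Qed.

Lemma cls_tpow i k : cls (tpow i k) = tA i ^+ k.
Proof.
elim: k => [|k IH] //; rewrite exprS -IH -clsM.
by congr cls; rewrite /cmul /= mul1r.
Qed.

Lemma cls_e i : cls (e_ d i) = frame_idem d tA i.
Proof.
rewrite /e_ clsZ cls_sum big_map sum_iota.
congr (_ *: _); apply: eq_bigr => s _.
by rewrite clsM (cls_tpow i s) (cls_tpow i.+1 (d - s)).
Qed.

Lemma trace_yokonuma_hecke : yokonuma_hecke d u gA tA.
Proof.
split=> [i j ij|i|i j|i|i|i|i j ji ji1|i]; rewrite /=.
- rewrite -!clsM; apply: cls_rel_sub; rewrite !cshift_mul.
  by apply: (@rel_gg _ _ i.+1 j.+1) => //; left.
- rewrite -[cls (g i) * cls (g i.+1)]clsM -[cls (g i.+1) * cls (g i)]clsM -!clsM.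
  by apply: cls_rel_sub; rewrite !cshift_mul; apply: (@rel_braid _ _ i.+1).
- rewrite -!clsM; apply: cls_rel_sub; rewrite !cshift_mul.
  exact: (@rel_tt _ _ i.+1 j.+1).
- rewrite -cls_tpow; apply: (@cls_rel_sub _ cone); rewrite cshift_tpow.
  exact: rel_td.
- rewrite -!clsM; apply: cls_rel_sub; rewrite !cshift_mul.
  exact: (@rel_gt1 _ _ i.+1).
- rewrite -!clsM; apply: cls_rel_sub; rewrite !cshift_mul.
  exact: (@rel_gt2 _ _ i.+1).
- rewrite -!clsM; apply: cls_rel_sub; rewrite !cshift_mul.
  exact: (@rel_gt3 _ _ i.+1 j.+1).
- transitivity (cls (cadd cone (cadd (cscale (u - 1) (e_ d i))
                                      (cscale (u - 1) (cmul (e_ d i) (g i)))))); last first.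
    rewrite -cls_e !clsD [cls (cscale _ (e_ d i))]clsZ.
    by rewrite [cls (cscale _ (cmul _ _))]clsZ clsM.
  rewrite -clsM; apply: cls_rel_sub.
  rewrite !(cshift_add, cshift_scale, cshift_mul, cshift_e).
  exact: (@rel_quad _ _ i.+1).
Qed.

Lemma cls_word_in n v : gen_in n (map shift_letter v) -> yh_sub gA tA n (cls (cw v)).
Proof.
elim/last_ind: v => [|v l IH]; first by move=> _; apply: yh_sub1.
rewrite map_rcons /gen_in all_rcons => /andP[ln /IH Yv].
have -> : cls (cw (rcons v l)) = cls (cw v) * cls (cw [:: l]).
  by rewrite -clsM; congr cls; rewrite /cmul /= cats1 mul1r.
case: l ln => i /= ln; [apply: yh_sub_g => // | apply: yh_sub_t => //]; lia.
Qed.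

(** Classes of words span [yh_sub n], so linear statements reduce to words, where the axioms on [T]
    apply. *)
Lemma yh_sub_word_ind n (P : A -> Prop) :
  P 0 -> (forall c a b, P a -> P b -> P (c *: a + b)) ->
  (forall v, gen_in n (map shift_letter v) -> P (cls (cw v))) ->
  forall a, yh_sub gA tA n a -> P a.
Proof.
move=> P0 Pl Pw a Ya.
elim: Ya P P0 Pl Pw => {a} [|a i lt_in _ IH|a i lt_in _ IH||c a b _ IHa _ IHb] P P0 Pl Pw.
- exact: (Pw [::]).
- apply: (IH (fun b => P (b * cls (g i)))) => [|c b b' Pb Pb'|v vn].
  + by rewrite mul0r.
  + by rewrite mulrDl -scalerAl; apply: Pl.
  + rewrite -clsM /cmul /= mul1r cats1; apply: Pw.
    by rewrite map_rcons /gen_in all_rcons /=; apply/andP; split=> //; lia.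
- apply: (IH (fun b => P (b * cls (t i)))) => [|c b b' Pb Pb'|v vn].
  + by rewrite mul0r.
  + by rewrite mulrDl -scalerAl; apply: Pl.
  + rewrite -clsM /cmul /= mul1r cats1; apply: Pw.
    by rewrite map_rcons /gen_in all_rcons /=; apply/andP; split=> //; lia.
- by [].
- by apply: (Pl); [apply: (IHa P) | apply: (IHb P)].
Qed.

(** The value 1 at 0 makes the framing rule valid for s = 0 as well. *)
Definition ext_param (s : nat) : C := if s == 0%N then 1 else x s.

Lemma trace_markov : markov_trace d gA tA tr z ext_param.
Proof.
case: TR => _ T1 TC Tg Tt; split.
- by apply: etrans (word_tr_cls T0_nil cone) _; rewrite ev_cw.
- elim/clsW=> a; elim/clsW=> b; rewrite -!clsM /= !word_tr_cls !ev_mul ev_swap.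
  apply: ev_ext => v; apply: ev_ext => v'; rewrite /= !map_cat.
  have [N1 H1] := gen_in_large v; have [N2 H2] := gen_in_large v'.
  by apply: (TC (maxn N1 N2)); [apply: H2; apply: leq_maxr | apply: H1; apply: leq_maxl].
- move=> n a; elim/yh_sub_word_ind=> [|c b b' Pb Pb'|v vn].
  + by rewrite mul0r linear0 mulr0.
  + by rewrite mulrDl -scalerAl !linearD !linearZ /= Pb Pb' mulrDr mulrCA.
  + rewrite -clsM /= !word_tr_cls ev_mul !ev_cw /= map_cat; exact: Tg.
- move=> n a s Ya sd; elim/yh_sub_word_ind: Ya => [|c b b' Pb Pb'|v vn].
  + by rewrite mul0r linear0 mulr0.
  + by rewrite mulrDl -scalerAl !linearD !linearZ /= Pb Pb' mulrDr mulrCA.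
  + rewrite -cls_tpow -clsM /= !word_tr_cls ev_mul !ev_cw /= map_cat map_nseq /ext_param.
    case: s sd => [|s] sd; first by rewrite cats0 mul1r.
    by apply: Tt => //=; lia.
Qed.

Lemma cls_r i : cls (r_ d i) = ftl_elt d gA tA i.
Proof.
rewrite /r_ clsM /ftl_elt; congr (_ * _).
  rewrite cls_sum big_allpairs_dep sum_iota.
  apply: eq_bigr => a _; rewrite sum_iota; apply: eq_bigr => b _.
  by rewrite !clsM (cls_tpow i a) (cls_tpow i.+1 (b + d - a)) (cls_tpow i.+2 (d - b)) mulrA.
rewrite /g2 cls_sum !big_cons big_nil addr0 !clsM /hecke_sum !addrA !mulrA.
by [].
Qed.

Lemma passes_FTL_alg n : passes_FTL d n T <->
  (forall i a b, (i.+2 < n)%N -> yh_sub gA tA n a -> yh_sub gA tA n b ->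
     tr (a * ftl_elt d gA tA i * b) = 0).
Proof.
(* The 1-based [r_ d i.+1] between shifted words is the 0-based [ftl_elt] at [i] between their
   classes. *)
have evE i v v' : ev T (cmul (cw (map shift_letter v)) (cmul (r_ d i.+1) (cw (map shift_letter v'))))
    = tr (cls (cw v) * ftl_elt d gA tA i * cls (cw v')).
  rewrite -cls_r -!clsM word_tr_cls -ev_cshift cshift_mul [cshift (cmul (cw v) _)]cshift_mul.
  rewrite cshift_r; move: (r_ d i.+1) => c; rewrite !ev_mul.
  rewrite -[cshift (cw v)]/(cw (map shift_letter v)) -[cshift (cw v')]/(cw (map shift_letter v')).
  rewrite !ev_cw ev_mul.
  by apply: ev_ext => v1; rewrite !ev_cw catA.
split=> [pass i a b lt_in Ya Yb | alg a b i an bn].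
  elim/yh_sub_word_ind: Ya => [|c a1 a2 P1 P2|v vn].
  - by rewrite !mul0r linear0.
  - by rewrite !mulrDl -!scalerAl linearD linearZ /= P1 P2 mulr0 addr0.
  elim/yh_sub_word_ind: Yb => [|c a1 a2 P1 P2|v' vn'].
  - by rewrite mulr0 linear0.
  - by rewrite mulrDr -scalerAr linearD linearZ /= P1 P2 mulr0 addr0.
  by rewrite -evE; apply: pass => //; lia.
have [v av] := shift_word_in an; have [v' bv] := shift_word_in bn.
case: i => // i lt_in; rewrite av bv evE; apply: alg; first by lia.
  by apply: cls_word_in; rewrite -av.
by apply: cls_word_in; rewrite -bv.
Qed.

End TraceAlgebra.

Theorem theorem5 (d n : nat) (u z : C) (x : nat -> C) (T : word -> C) :
  (1 <= d)%N -> (3 <= n)%N -> u != 0 ->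
  is_markov_trace d u z x T ->
  (passes_FTL d n T <->
   exists Sup1 Sup2 : {set 'I_d},
     [/\ [disjoint Sup1 & Sup2],
         Sup1 :|: Sup2 = [set m | xhat x m != 0],
         (forall k : 'I_d,
            xfun x k = - z * (\sum_(m in Sup1) omega d ^+ (k * m)
                              + (u + 1) * \sum_(m in Sup2) omega d ^+ (k * m))),
         (#|Sup1|%:R + (u + 1) * #|Sup2|%:R : C) != 0 &
         z = - (#|Sup1|%:R + (u + 1) * #|Sup2|%:R)^-1]).
Proof.
move=> d_gt0 n3 u0 TR; have wP := omega_primitive d_gt0; have d0 := natC_neq0 d_gt0.
have YH := trace_yokonuma_hecke TR.
have [pass ftl] := passes_FTL_alg TR n.
have [alg coef] := markov_trace_ftl YH wP d0 u0 (trace_markov TR) n3.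
(* On ['I_d] the function [ext_param x] unfolds to [xfun x], so the sums in [fourier_support] are
   those of [xhat]; [erefl] proves its value at 0. *)
have [sup csup] := @fourier_support C d (omega d) (ext_param x) wP d0 u z erefl.
by split=> [/pass/alg/sup | /csup/coef/ftl].
Qed.
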